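(* Let $\mathcal U\subset\mathbb R^{n_\xi}$ be convex (and compact), and let $g:\mathcal X\times\mathcal Y\times\mathcal U\to\mathbb R$ be a continuous function such that $g(x,y,\xi)$ is concave in $\xi$ for every $x\in\mathcal X$, $y\in\mathcal Y$. Then the number of second-stage policies $k$ needed in the $k$-adaptability problem $$\inf_{\substack{x\in\mathcal X\\ y^1,\ldots,y^k\in\mathcal Y(x)}}\ \sup_{\xi\in\mathcal U}\ \inf_{i=1,\ldots,k} f(x,y^i,\xi)$$ to ensure an optimal solution for the two-stage robust problem $$\inf_{x\in\mathcal X}\ \sup_{\xi\in\mathcal U}\ \inf_{y\in\mathcal Y(x)} f(x,y,\xi)$$ is (i) $k\in\mathcal O\big(\eta^{\min\{m,n_\xi\}}(n_\xi+1)\big)$ if fixed recourse holds, i.e. $B(\xi)=B$ for all $\xi\in\mathcal U$; (ii) $k\in\mathcal O\big(\eta^{n_\xi}(n_\xi+1)\big)$ if random recourse holds, i.e. $B(\xi)$ may depend on $\xi$.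
   Context: $\mathcal X\subseteq\mathbb R^{n_x}$ is compact, $\mathcal Y\subset\mathbb Z^{n_y}$ is bounded (hence finite), and $\mathcal Y(x)\subseteq\mathcal Y$ for each $x\in\mathcal X$. The function $f$ is $$f(x,y,\xi):=\begin{cases} g(x,y,\xi) & \text{if } A(\xi)x+B(\xi)y\ge h(\xi),\\ \infty & \text{otherwise,}\end{cases}$$ with constraint parameters that are affine in $\xi$: $$h(\xi)=h+H\xi,\quad A(\xi)=A+\sum_{i=1}^{n_\xi}A^i\xi_i,\quad B(\xi)=B+\sum_{i=1}^{n_\xi}B^i\xi_i,$$ where $h\in\mathbb Z^m$, $H\in\mathbb Z^{m\times n_\xi}$, $A,A^i\in\mathbb Z^{m\times n_x}$, $B,B^i\in\mathbb Z^{m\times n_y}$; thus $m$ is the number of second-stage constraints. For $x\in\mathcal X$, $y\in\mathcal Y(x)$, let $a_l(x,y)$ be the $l$-th row of the $m\times n_\xi$ matrix $(A^1x+B^1y-H_1,\ldots,A^{n_\xi}x+B^{n_\xi}y-H_{n_\xi})$, where $H_i$ is the $i$-th column of $H$, and let $h_l(x,y)$ be the $l$-th entry of $h-Ax-By$. The constraint system $A(\xi)x+B(\xi)y\ge h(\xi)$ is then $a_l(x,y)^\top\xi\ge h_l(x,y)$, $l=1,\ldots,m$. Define the set of hyperplanes intersecting $\mathcal U$ $$\mathcal H(x):=\{P_l(y)=\{\xi: a_l(x,y)^\top\xi=h_l(x,y)\}\ :\ P_l(y)\cap\mathcal U\ne\emptyset,\ y\in\mathcal Y(x),\ l=1,\ldots,m\}.$$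 Let $\mathcal X_{\mathrm{feas}}$ be the set of $x\in\mathcal X$ feasible for the two-stage robust problem, i.e. such that for every $\xi\in\mathcal U$ there is $y\in\mathcal Y(x)$ with $A(\xi)x+B(\xi)y\ge h(\xi)$, and $$\eta:=\max\Big\{1,\ \max_{x\in\mathcal X_{\mathrm{feas}}}|\mathcal H(x)|\Big\}.$$ It is assumed that the $k$-adaptability problem with $k=1$ has at least one feasible solution, i.e. there are $x\in\mathcal X$ and $y\in\mathcal Y(x)$ with $A(\xi)x+B(\xi)y\ge h(\xi)$ for all $\xi\in\mathcal U$, so that the two-stage problem and the $k$-adaptability problem are feasible for every $k$. *)

(* Defs.v *)
From HB Require Import structures.
From mathcomp Require Import all_boot all_order all_algebra finmap.
From mathcomp Require Import all_classical all_reals all_analysis.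

Set Implicit Arguments.
Unset Strict Implicit.
Unset Printing Implicit Defensive.

Import Order.TTheory GRing.Theory Num.Theory.
Import numFieldNormedType.Exports.

Local Open Scope classical_set_scope.
Local Open Scope ring_scope.

(* [Yset] and [Yat x] are sets of real vectors; membership in Z^ny is expressed by
   [mxOver Num.int]. The values of [cost] outside Xset * Yset * Uset are irrelevant. *)
Record instance (R : realType) (nx ny nxi m : nat) := Instance {
  Xset : set 'cV[R]_nx;
  Yset : set 'cV[R]_ny;
  Yat : 'cV[R]_nx -> set 'cV[R]_ny;
  Uset : set 'cV[R]_nxi;
  cost : 'cV[R]_nx -> 'cV[R]_ny -> 'cV[R]_nxi -> R;
  h0 : 'cV[int]_m;
  H0 : 'M[int]_(m, nxi);
  A0 : 'M[int]_(m, nx);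
  Ai : 'I_nxi -> 'M[int]_(m, nx);
  B0 : 'M[int]_(m, ny);
  Bi : 'I_nxi -> 'M[int]_(m, ny)
}.

Section Problems.
Context {R : realType} {nx ny nxi m : nat} (P : instance R nx ny nxi m).
Implicit Types (x : 'cV[R]_nx) (y : 'cV[R]_ny) (xi : 'cV[R]_nxi).

Local Notation real M := (map_mx (intr : int -> R) M).

Definition h_ xi : 'cV[R]_m := real (h0 P) + real (H0 P) *m xi.
Definition A_ xi : 'M[R]_(m, nx) :=
  real (A0 P) + \sum_i xi i 0 *: real (Ai P i).
Definition B_ xi : 'M[R]_(m, ny) :=
  real (B0 P) + \sum_i xi i 0 *: real (Bi P i).

Definition satisfies x y xi : bool :=
  [forall l, h_ xi l 0 <= (A_ xi *m x + B_ xi *m y) l 0].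

Definition obj x y xi : \bar R := if satisfies x y xi then (cost P x y xi)%:E else +oo%E.

Definition two_stage_obj x : \bar R :=
  ereal_sup [set ereal_inf [set obj x y xi | y in Yat P x] | xi in Uset P].

Definition two_stage_val : \bar R := ereal_inf [set two_stage_obj x | x in Xset P].

Definition two_stage_opt x : Prop := Xset P x /\ two_stage_obj x = two_stage_val.

Definition adapt_obj k x (ys : 'I_k -> 'cV[R]_ny) : \bar R :=
  ereal_sup [set ereal_inf (range (fun i => obj x (ys i) xi)) | xi in Uset P].

Definition adapt_dom k : set ('cV[R]_nx * ('I_k -> 'cV[R]_ny)) :=
  [set p | Xset P p.1 /\ forall i, Yat P p.1 (p.2 i)].

Definition adapt_val k : \bar R :=
  ereal_inf [set adapt_obj p.1 p.2 | p in @adapt_dom k].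

Definition adapt_opt k x (ys : 'I_k -> 'cV[R]_ny) : Prop :=
  adapt_dom (x, ys) /\ adapt_obj x ys = adapt_val k.

(* The infima need not be attained, so the optimal values are compared as well
   as the optimal solutions. The premise [Yat P x !=set0] only matters when Uset is
   empty: otherwise it follows from optimality of [x] as soon as the two-stage
   problem is feasible. *)
Definition ensures_optimal k : Prop :=
  [/\ adapt_val k = two_stage_val,
      forall x (ys : 'I_k -> 'cV[R]_ny), adapt_opt x ys -> two_stage_opt x
    & forall x, two_stage_opt x -> Yat P x !=set0 ->
        exists ys : 'I_k -> 'cV[R]_ny, adapt_opt x ys].

Definition Xfeas : set 'cV[R]_nx :=
  [set x | Xset P x /\
    forall xi, Uset P xi -> exists y, Yat P x y /\ satisfies x y xi].

Definition a_mx x y : 'M[R]_(m, nxi) :=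
  \matrix_(l, i)
    (real (Ai P i) *m x + real (Bi P i) *m y - col i (real (H0 P))) l 0.

Definition h_vec x y : 'cV[R]_m :=
  real (h0 P) - real (A0 P) *m x - real (B0 P) *m y.

Definition hyperplane x y (l : 'I_m) : set 'cV[R]_nxi :=
  [set xi | (row l (a_mx x y) *m xi) 0 0 = h_vec x y l 0].

Definition hyperplanes x : set (set 'cV[R]_nxi) :=
  [set Q | exists y l,
     [/\ Yat P x y, Q = hyperplane x y l & Q `&` Uset P !=set0]].

(* [#|` fset_set A |] is the cardinality of a finite [A] and 0 otherwise, and
   [hyperplanes x] is finite when Yat P x is. The cardinalities are then at most
   m * #|Yset|, so the [sup] of this set of naturals is a maximum. *)
Definition etaH : R :=
  Num.max 1 (sup [set (#|` fset_set (hyperplanes x)|)%:R | x in Xfeas]).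

Definition fixed_recourse : Prop :=
  forall xi, Uset P xi -> B_ xi = real (B0 P).

(* [ensures_optimal] is monotone in k, so this bounds the least sufficient k. *)
Definition policies_needed_le (b : R) : Prop :=
  exists k0 : nat, k0%:R <= b /\
    forall k : nat, (k0 <= k)%N -> ensures_optimal k.

End Problems.

(* Main.v *)
Require Import Defs.
From HB Require Import structures.
From mathcomp Require Import all_boot all_order all_algebra finmap.
From mathcomp Require Import all_classical all_reals all_analysis.
From mathcomp Require Import zify ring lra.

(* Fix a feasible [x]. Among the hyperplanes meeting U, those that do not contain
   U cut U into cells on which the set of feasible policies is constant. The cells
   are counted by the strict sign patterns of N affine functions. By Pajor's lemma
   there are at most as many patterns as shattered sets of indices, and a shattered
   set has at most d elements as soon as any d+1 of the functions satisfy a linear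
   relation modulo constants on U: d = nxi always works, and with fixed recourse
   also d = m, because the linear part of the l-th constraint no longer depends
   on y. Hence there are at most 1 + N^d <= 2 eta^d cells.
   On one cell, let v be the two-stage value at [x]. The sets {g(x,y,.) > v}, for
   the y feasible there, are convex with empty intersection, so by Helly's theorem
   nxi+1 of these y already keep the cost at most v on the whole cell. A point of U
   outside the cells is reached from a generic point along a segment, where
   concavity of g gives the semicontinuity needed to pass to the limit. *)

Set Implicit Arguments.
Unset Strict Implicit.
Unset Printing Implicit Defensive.

Import Order.TTheory GRing.Theory Num.Theory.
Import numFieldNormedType.Exports.

Local Open Scope ring_scope.

(** * Shattered sets and Pajor's lemma *)

Section Shattering.
Variable T : finType.
Implicit Types (F : {set {set T}}) (S : {set T}).

Definition shatters F S :=
  [forall B : {set T}, (B \subset S) ==> [exists C in F, C :&: S == B]].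

Lemma shattersP F S :
  reflect (forall B : {set T}, B \subset S -> exists2 C, C \in F & C :&: S = B)
          (shatters F S).
Proof.
apply: (iffP forallP) => [sh B BS|sh B].
  by have /implyP /(_ BS) /exists_inP [C CF /eqP CB] := sh B; exists C.
by apply/implyP => /sh [C CF CB]; apply/exists_inP; exists C => //; apply/eqP.
Qed.

Lemma shatters_sub F F' S : F \subset F' -> shatters F S -> shatters F' S.
Proof.
move=> /fintype.subsetP FF' /shattersP sh; apply/shattersP => B /sh [C /FF' CF CB].
by exists C.
Qed.

(** Induction on [#|F|]: an element [x] separating two members splits [F] into two smaller nonempty
    families. A set shattered by both halves has to count twice, and adjoining [x] to it supplies
    the second shattered set. *)
Lemma card_le_shattered F : (#|F| <= #|[set S | shatters F S]|)%N.
Proof.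
have [n] := ubnP #|F|; elim: n F => // n IHn F; rewrite ltnS => Fn.
have [F1|F1] := leqP #|F| 1.
  have [->|[C CF]] := set_0Vmem F; first by rewrite cards0.
  apply: leq_trans F1 _; rewrite card_gt0; apply/set0Pn; exists finset.set0.
  rewrite inE; apply/shattersP => B; rewrite finset.subset0 => /eqP ->.
  by exists C; rewrite ?finset.setI0.
have [C [D [CF DF CD]]] : exists C D, [/\ C \in F, D \in F & C != D].
  by apply/card_gt1P.
wlog [x xC xD] : C D CF DF CD / exists2 x, x \in C & x \notin D.
  move=> H; have [|/subsetPn [x]] := boolP (C \subset D); last first.
    by move=> xC xD; apply: (H C D) => //; exists x.
  move=> sCD; have /subsetPn[x xD xC] : ~~ (D \subset C).
    by apply: contra CD => sDC; rewrite finset.eqEsubset sCD.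
  by apply: (H D C) => //; [rewrite eq_sym | exists x].
pose F1' := [set A in F | x \in A]; pose F0 := [set A in F | x \notin A].
have FE : (#|F1'| + #|F0| = #|F|)%N.
  rewrite -(cardsID [set A : {set T} | x \in A] F).
  by congr (_ + _)%N; apply: eq_card => A; rewrite !inE // andbC.
have pos1 : (0 < #|F1'|)%N.
  by rewrite card_gt0; apply/set0Pn; exists C; rewrite inE CF.
have pos0 : (0 < #|F0|)%N.
  by rewrite card_gt0; apply/set0Pn; exists D; rewrite inE DF.
have lt1 : (#|F1'| < n)%N.
  by apply: leq_trans Fn; rewrite -FE -addn1 leq_add2l.
have lt0 : (#|F0| < n)%N.
  by apply: leq_trans Fn; rewrite -FE addnC -addn1 leq_add2l.
have sub1 : F1' \subset F by apply/fintype.subsetP => A; rewrite inE => /andP[].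
have sub0 : F0 \subset F by apply/fintype.subsetP => A; rewrite inE => /andP[].
set sh := fun G => [set S | shatters G S].
have nx1 S : shatters F1' S -> x \notin S.
  move=> /shattersP /(_ finset.set0 (finset.sub0set _)) [A].
  rewrite inE => /andP[_ xA] AS.
  apply/negP => xS; have : x \in A :&: S by rewrite inE xA.
  by rewrite AS inE.
have nx0 S : shatters F0 S -> x \notin S.
  move=> /shattersP /(_ S (subxx _)) [A]; rewrite inE => /andP[_ xA] AS.
  by apply/negP; rewrite -AS inE (negPf xA).
(* These sets contain [x], whereas no set shattered by a single half does. *)
pose both := [set x |: S | S in sh F1' :&: sh F0].
have cboth : #|both| = #|sh F1' :&: sh F0|.
  apply: card_in_imset => S S'; rewrite !inE => /andP[/nx1 xS _] /andP[/nx1 xS' _].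
  by move=> e; rewrite -(setU1K xS) -(setU1K xS') e.
rewrite -FE; apply: (@leq_trans (#|sh F1'| + #|sh F0|)).
  by apply: leq_add; apply: IHn.
rewrite -cardsUI -cboth.
suff : [disjoint sh F1' :|: sh F0 & both].
  move=> dis.
  suff sub : (sh F1' :|: sh F0) :|: both \subset sh F.
    apply: leq_trans (subset_leq_card sub).
    by rewrite [leqRHS]cardsU (disjoint_setI0 dis) cards0 subn0.
  apply/fintype.subsetP => S; rewrite !inE => /orP[/orP[|]|].
  - exact: shatters_sub.
  - exact: shatters_sub.
  - move=> /imsetP[S' ]; rewrite !inE => /andP[s1 s0] ->.
    apply/shattersP => B Bx; have BS : B :\ x \subset S' by rewrite subDset.
    have [xB|xB] := boolP (x \in B).
      have /shattersP /(_ _ BS) [A] := s1; rewrite inE => /andP[AF xA] AS.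
      exists A => //; rewrite finset.setIUr AS -[RHS](finset.setD1K xB); congr (_ :|: _).
      by apply/finset.setIidPr; rewrite finset.sub1set.
    have /shattersP /(_ _ BS) [A] := s0; rewrite inE => /andP[AF xA] AS.
    exists A => //; rewrite finset.setIUr AS (_ : A :&: [set x] = finset.set0).
      rewrite finset.set0U; apply/setP => z; rewrite !inE.
      by case: eqP => // ->; rewrite (negPf xB).
    by apply/setP => z; rewrite !inE; case: eqP => [->|]; rewrite ?(negPf xA) ?andbF.
rewrite disjoint_subset; apply/fintype.subsetP => S; rewrite !inE => Sh.
apply/imsetP => -[S' _ SE]; have : x \in S by rewrite SE setU11.
by case/orP: Sh => [/nx1|/nx0] /negPf ->.
Qed.

(** A nonempty set of at most [d] elements is the image of a map from ['I_d]; the extra 1 pays for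
    the empty set. *)
Lemma card_small_sets d : (#|[set S : {set T} | #|S| <= d]| <= 1 + #|T| ^ d)%N.
Proof.
pose im (f : {ffun 'I_d -> T}) := [set f i | i in 'I_d].
have sub : [set S : {set T} | #|S| <= d]%N \subset
    finset.set0 |: [set im f | f in {ffun 'I_d -> T}].
  apply/fintype.subsetP => S; rewrite !inE => Sd.
  have [->|[x0 x0S]] := set_0Vmem S; first by rewrite eqxx.
  apply/orP; right; apply/imsetP.
  (* The default [x0] lies in [S], so indices past the end of the enumeration add nothing. *)
  exists [ffun i : 'I_d => nth x0 (enum S) i] => //; apply/setP => x.
  apply/idP/imsetP => [xS|[i _ ->]].
    have xd : (index x (enum S) < d)%N.
      by apply: leq_trans Sd; rewrite cardE index_mem mem_enum.
    by exists (Ordinal xd) => //; rewrite ffunE nth_index ?mem_enum.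
  rewrite ffunE; have [iS|iS] := ltnP i (size (enum S)).
    by rewrite -mem_enum mem_nth.
  by rewrite nth_default.
apply: leq_trans (subset_leq_card sub) _.
rewrite cardsU1 leq_add ?leq_b1 //.
by apply: leq_trans (leq_imset_card _ _) _; rewrite card_ffun card_ord.
Qed.

End Shattering.

(** * Linear dependence of more vectors than the dimension *)

Section LinearDependence.
Variable F : fieldType.

Lemma exists_linear_dependence (I : finType) d (v : I -> 'rV[F]_d) (S : {set I}) :
  (d < #|S|)%N ->
  exists c : I -> F, [/\ forall i, i \notin S -> c i = 0, exists i, c i != 0
                       & \sum_i c i *: v i = 0].
Proof.
move=> dS; pose M : 'M[F]_(#|S|, d) := \matrix_k v (enum_val k).
have : kermx M != 0.
  rewrite kermx_eq0 /row_free neq_ltn; apply/orP; left.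
  exact: leq_ltn_trans (rank_leq_col _) dS.
move=> /rowV0Pn [u /sub_kermxP uM u0].
(* The kernel vector [u] transported to [I] and extended by zero outside [S]: each sum has at most
   one term. *)
pose c i := \sum_(k | enum_val k == i) u 0 k.
have cE k : c (enum_val k) = u 0 k.
  rewrite /c (eq_bigl (pred1 k)) ?big_pred1_eq // => k' /=.
  by rewrite (inj_eq enum_val_inj).
exists c; split.
- move=> i iS; rewrite /c big_pred0 // => k; apply/negP => /eqP ki.
  by rewrite -ki enum_valP in iS.
- by have /rV0Pn [k uk] := u0; exists (enum_val k); rewrite cE.
- rewrite -[RHS]uM mulmx_sum_row; under eq_bigr => i _ do rewrite /c scaler_suml.
  rewrite (exchange_big_dep xpredT) //=; apply: eq_bigr => k _.
  by rewrite (big_pred1 (enum_val k)) ?rowK // => i; rewrite eq_sym.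
Qed.

End LinearDependence.

Local Open Scope classical_set_scope.

(** * Convex sets and convex combinations *)

Section Convexity.
Variables (R : realType) (E : lmodType R).
Implicit Types (A : set E) (p q : E).

Lemma convex_setP A : convex_set A <->
  forall p q (t : R), A p -> A q -> 0 <= t -> t <= 1 -> A (t *: p + (1 - t) *: q).
Proof.
split=> [cA p q t Ap Aq t0 t1|cA p q t /set_mem Ap /set_mem Aq].
  by have := cA p q (Itv01 t0 t1) (mem_set Ap) (mem_set Aq) => /set_mem.
by apply/mem_set/cA.
Qed.

Lemma convex_functionP A (f : E -> R) : convex_function A f ->
  forall p q (t : R), A p -> A q -> 0 <= t -> t <= 1 ->
    f (t *: p + (1 - t) *: q) <= t * f p + (1 - t) * f q.
Proof.
move=> cf p q t Ap Aq t0 t1.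
exact: (cf (Itv01 t0 t1) p q (mem_set Ap) (mem_set Aq)).
Qed.

(** Unnormalised weights, with membership asked only where the weight is nonzero, suit the positive
    and negative parts of a Radon relation. *)
Lemma convex_combination A (I : finType) (w : I -> R) (p : I -> E) :
  convex_set A -> (forall i, 0 <= w i) -> 0 < \sum_i w i ->
  (forall i, w i != 0 -> A (p i)) ->
  A ((\sum_i w i)^-1 *: \sum_i w i *: p i).
Proof.
move=> /convex_setP cA w0 + Ap.
elim: (index_enum I) => [|i r IHr]; first by rewrite big_nil ltxx.
rewrite !big_cons; have [->|wi] := eqVneq (w i) 0; first by rewrite scale0r !add0r.
have wi0 : 0 < w i by rewrite lt_def wi w0.
have := sumr_ge0 (P := xpredT) r (fun i _ => w0 i).
rewrite le_eqVlt => /orP[/eqP/esym r0|r0 _].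
  (* The remaining weights are nonnegative with sum zero, so only [p i] survives. *)
  rewrite r0 => _; have -> : \sum_(j <- r) w j *: p j = 0; last first.
    by rewrite !addr0 scalerA mulVf // scale1r; exact: Ap.
  rewrite big_seq big1 // => j jr; move/eqP: r0.
  rewrite psumr_eq0 => [|//] /allP /(_ _ jr) /= /eqP ->.
  by rewrite scale0r.
set s := \sum_(j <- r) w j in r0 IHr *; set v := \sum_(j <- r) _ in IHr *.
have s0 : 0 < w i + s by rewrite addr_gt0.
have := cA _ _ (w i / (w i + s)) (Ap _ wi) (IHr r0).
rewrite divr_ge0 ?(ltW wi0) ?(ltW s0) // ler_pdivrMr // mul1r lerDl (ltW r0).
move=> /(_ isT isT); congr A; rewrite scalerDr !scalerA mulrC; congr (_ + _ *: _).
by field; rewrite (gt_eqF r0) (gt_eqF s0).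
Qed.

End Convexity.

(** * The theorems of Radon and Helly *)

Section Helly.
Variables (R : realType) (n : nat).

(** Prepending a coordinate 1 turns affine dependence into linear dependence in dimension n+1; the
    relation is then split into its positive and negative parts. *)
Lemma radon (I : finType) (p : I -> 'cV[R]_n) (S : {set I}) :
  (n.+1 < #|S|)%N ->
  exists c : I -> R, [/\ forall i, i \notin S -> c i = 0,
    0 < \sum_i Num.max (c i) 0, \sum_i Num.max (c i) 0 = \sum_i Num.max (- c i) 0 &
    \sum_i Num.max (c i) 0 *: p i = \sum_i Num.max (- c i) 0 *: p i].
Proof.
move=> nS.
have [|c [cS [i0 ci0] cv]] := @exists_linear_dependence _ _ _
  (fun i => row_mx (1%:M : 'M[R]_1) (p i)^T) S; first by rewrite add1n.
have E x : Num.max x 0 - Num.max (- x) 0 = x :> R.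
  by rewrite /Num.max; case: ltP => ?; case: ltP => ?; lra.
have c1 : \sum_i c i = 0.
  have := congr1 (fun u => lsubmx u 0 0) cv; rewrite linear_sum summxE /= !mxE.
  move=> c1; rewrite -[RHS]c1; apply: eq_bigr => i _.
  rewrite scale_row_mx row_mxKl !mxE eqxx.
  by rewrite mulr1.
have cp : \sum_i c i *: p i = 0.
  apply: trmx_inj; have := congr1 (fun u => rsubmx u) cv.
  have z : rsubmx (0 : 'M[R]_(1, 1 + n)) = 0 by apply/matrixP => i j; rewrite !mxE.
  rewrite !linear_sum /= trmx0 z => e; rewrite -[RHS]e.
  by apply: eq_bigr => i _; rewrite scale_row_mx row_mxKr linearZ.
have sE : \sum_i Num.max (c i) 0 = \sum_i Num.max (- c i) 0.
  apply/eqP; rewrite -subr_eq0 -sumrB; under eq_bigr => i _ do rewrite E.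
  by rewrite c1.
exists c; split => //; last first.
  apply/eqP; rewrite -subr_eq0 -sumrB; under eq_bigr => i _ do rewrite -scalerBl E.
  by rewrite cp.
rewrite lt_def sumr_ge0 ?andbT => [|i _]; last by rewrite le_max lexx orbT.
(* If the positive parts summed to zero, so would the negative parts, and [c i0] would vanish. *)
apply/eqP => s0; move/eqP: ci0; apply; rewrite -[c i0]E.
have Z (d : I -> R) : \sum_i Num.max (d i) 0 = 0 -> Num.max (d i0) 0 = 0.
  move=> /eqP; rewrite psumr_eq0 => [|i _]; last by rewrite le_max lexx orbT.
  by move=> /allP /(_ i0 (mem_index_enum _)) /eqP.
by rewrite Z // (Z (fun i => - c i)) ?subrr // -sE.
Qed.

(** Induction on the size of a subfamily [S]: for each [i] in [S] take a point [p i] common to the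
    other sets; the Radon point of the [p i] lies in all of them. *)
Theorem helly (I : finType) (K : I -> set 'cV[R]_n) :
  (forall i, convex_set (K i)) ->
  (forall S : {set I}, (#|S| <= n.+1)%N -> exists p, forall i, i \in S -> K i p) ->
  exists p, forall i, K i p.
Proof.
move=> cK hK.
suff H (S : {set I}) : exists p, forall i, i \in S -> K i p.
  by have [p pK] := H [set: I]%SET; exists p => i; apply: pK; rewrite inE.
have [k] := ubnP #|S|; elim: k S => // k IHk S Sk.
have [|nS] := leqP #|S| n.+1; first exact: hK.
have {}IHk i : exists p, i \in S -> forall j, j \in S :\ i -> K j p.
  have [iS|] := boolP (i \in S); last by exists 0.
  have [|p Kp] := IHk (S :\ i); last by exists p.
  by move: Sk; rewrite (cardsD1 i) iS.
have [p pK] := choice IHk.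
have [c [cS c0 cE cp]] := radon p nS.
have nz (d : R) : Num.max d 0 != 0 -> 0 < d.
  by rewrite /Num.max; case: ltP; rewrite ?eqxx // lt_def => -> ->.
exists ((\sum_i Num.max (c i) 0)^-1 *: \sum_i Num.max (c i) 0 *: p i) => j jS.
have inS i : c i != 0 -> i \in S by apply: contraNT => /cS ->; rewrite eqxx.
(* The Radon point is written over the side of the relation that omits [j]; every [p i] used there
   lies in [K j]. *)
have [cj|cj] := lerP (c j) 0.
  apply: convex_combination => // [i|i /nz ci]; first by rewrite le_max lexx orbT.
  apply: pK; first by rewrite inS // gt_eqF.
  by rewrite !inE jS andbT; apply/eqP => ji; rewrite ji leNgt ci in cj.
rewrite cE cp; apply: convex_combination => // [i||i /nz ci].
- by rewrite le_max lexx orbT.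
- by rewrite -cE.
- apply: pK; first by rewrite inS // lt_eqF // -oppr_gt0.
  rewrite !inE jS andbT; apply/eqP => ji; move: ci; rewrite -ji; lra.
Qed.

End Helly.

(** * Strict inequalities along segments *)

Lemma conv_gt (R : realFieldType) (v a b t : R) :
  v < a -> v < b -> 0 <= t -> t <= 1 -> v < t * a + (1 - t) * b.
Proof.
move=> va vb t0 t1; have [->|t0'] := eqVneq t 0; first by rewrite mul0r add0r subr0 mul1r.
have : 0 < t by rewrite lt_def t0' t0.
by nra.
Qed.

Lemma near0_conv_gt (R : realType) (v a b : R) :
  v < a -> \forall t \near 0^'+, v < t * b + (1 - t) * a.
Proof.
move=> va; pose D := 1 + `|b - a|; have D0 : 0 < D by rewrite ltr_pwDl.
have e0 : 0 < (a - v) / D by rewrite divr_gt0 // subr_gt0.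
near=> t.
have t0 : 0 < t by near: t; exact: nbhs_right_gt.
have : t < (a - v) / D by near: t; exact: nbhs_right_lt.
rewrite ltr_pdivlMr // /D => te.
have : - `|b - a| <= b - a by rewrite lerNnormlW.
nra.
Unshelve. all: by end_near. Qed.

Lemma leq_card_bigcup (I T : finType) (A : {set I}) (F : I -> {set T}) :
  (#|(\bigcup_(i in A) F i)%SET| <= \sum_(i in A) #|F i|)%N.
Proof.
elim/big_rec2 : _ => [|i m B _ mB]; first by rewrite cards0.
by rewrite (leq_trans (leq_card_setU _ _)) // leq_add2l.
Qed.

(** The value [e] is left free: a combination that is constant on [U] cannot take both signs there,
    which is all that shattering will contradict. *)
Definition dependent_on (R : realType) n (U : set 'cV[R]_n) (J : finType)
    (f : J -> 'cV[R]_n -> R) (S : {set J}) : Prop :=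
  exists c : J -> R, [/\ forall j, j \notin S -> c j = 0, exists j, c j != 0
    & exists e, forall p, U p -> \sum_j c j * f j p = e].

Definition affine (R : realType) n (f : 'cV[R]_n -> R) :=
  forall p q t, f (t *: p + (1 - t) *: q) = t * f p + (1 - t) * f q.

(** * Cells of a hyperplane arrangement and the finite cover *)

Section Cover.
Variables (R : realType) (n d : nat) (U : set 'cV[R]_n).
Variables (K : finType) (L : Type) (J : finType).
Variables (al : K -> L -> 'cV[R]_n -> R) (be : J -> 'cV[R]_n -> R).
Variables (g : K -> 'cV[R]_n -> R) (v : R).

Hypothesis convU : convex_set U.
Hypothesis al_affine : forall k l, affine (al k l).
Hypothesis be_affine : forall j, affine (be j).
(** Only zero sets inside [U] are matched, so policies and constraints sharing a hyperplane share
    one index [j]. This makes the count depend on hyperplanes rather than on pairs. *)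
Hypothesis be_al : forall k l, (exists2 p, U p & al k l p = 0) ->
  exists j, forall p, U p -> be j p = 0 <-> al k l p = 0.
Hypothesis concave_g : forall k, convex_function U (\- g k).
Hypothesis be_dep : forall S : {set J}, (d < #|S|)%N -> dependent_on U be S.

Let feas k p := forall l, 0 <= al k l p.

Hypothesis feas_le : forall p, U p -> exists2 k, feas k p & g k p <= v.

(* Functions vanishing identically on [U] do not cut [U], so they are ignored here. *)
Let generic p := U p /\ forall j, be j p = 0 -> forall q, U q -> be j q = 0.

(** At a generic point, an index outside the pattern has [be j] negative there or zero on all of
    [U]; the positive indices thus determine every sign. *)
Let pattern p := [set j | 0 < be j p]%SET.

Let mem_conv p q (t : R) : U p -> U q -> 0 <= t -> t <= 1 -> U (t *: p + (1 - t) *: q).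
Proof. by move: convU => /convex_setP; apply. Qed.

Lemma near0_mem_conv p q : U p -> U q -> \forall t \near 0^'+, U (t *: p + (1 - t) *: q).
Proof.
move=> Up Uq; near=> t.
have t0 : 0 < t by near: t; exact: nbhs_right_gt.
have t1 : t < 1 by near: t; exact: nbhs_right_lt.
by apply: mem_conv => //; exact: ltW.
Unshelve. all: by end_near. Qed.

Lemma near0_affine_neq0 (f : 'cV[R]_n -> R) p q : affine f ->
  f q != 0 -> \forall t \near 0^'+, f (t *: p + (1 - t) *: q) != 0.
Proof.
move=> af; rewrite neq_lt => /orP[fq|fq].
  have fq' : 0 < - f q by rewrite oppr_gt0.
  near=> t; rewrite af lt_eqF // -oppr_gt0 opprD -!mulrN.
  by near: t; exact: near0_conv_gt.
near=> t; rewrite af gt_eqF //.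
by near: t; exact: near0_conv_gt.
Unshelve. all: by end_near. Qed.

(** The functions are treated one at a time: if [be j] vanishes at [p] but not at some [q] of [U], a
    small move towards [q] makes it nonzero and keeps the nonzero values nonzero. *)
Lemma exists_generic : U !=set0 -> exists p, generic p.
Proof.
move=> [p0 Up0].
suff [p Up gp] : exists2 p, U p &
    forall j, j \in enum J -> be j p = 0 -> forall q, U q -> be j q = 0.
  by exists p; split=> // j; apply: gp; rewrite mem_enum.
elim: (enum J) => [|j s [p Up gp]]; first by exists p0.
have [bp|bp] := eqVneq (be j p) 0; last first.
  exists p => // i; rewrite inE => /orP[/eqP ->|]; last exact: gp.
  by move=> bp0; rewrite bp0 eqxx in bp.
have [triv|] := pselect (forall q, U q -> be j q = 0).
  by exists p => // i; rewrite inE => /orP[/eqP -> //|]; exact: gp.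
move=> /existsNP[q /not_implyP[Uq /eqP bq]].
suff [t [Ut bt st]] : exists t, [/\ U (t *: q + (1 - t) *: p),
    be j (t *: q + (1 - t) *: p) != 0 & forall i, be i p != 0 ->
    be i (t *: q + (1 - t) *: p) != 0].
  exists (t *: q + (1 - t) *: p) => // i; rewrite inE => /orP[/eqP -> /eqP|].
    by rewrite (negPf bt).
  move=> si /eqP bi; apply: gp => //; apply/eqP; apply: contraTT bi; exact: st.
near (0 : R)^'+ => t; exists t; split.
- by near: t; exact: near0_mem_conv.
- have t0 : 0 < t by near: t; exact: nbhs_right_gt.
  by rewrite be_affine bp mulr0 addr0 mulf_neq0 // gt_eqF.
- near: t; apply: filter_forall => i.
  have [bi|bi] := eqVneq (be i p) 0; first by apply: nearW.
  by apply: filterS (near0_affine_neq0 q (be_affine i) bi).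
Unshelve. all: by end_near. Qed.

(** A function nonzero at [p] has at most one zero on the segment, so all small t > 0 avoid it. *)
Lemma near0_generic p q : generic p -> U q ->
  \forall t \near 0^'+, generic (t *: p + (1 - t) *: q).
Proof.
move=> [Up gp] Uq.
have : \forall t \near 0^'+, forall j, be j p != 0 -> be j (t *: p + (1 - t) *: q) != 0.
  apply: filter_forall => j; have [bj|bj] := eqVneq (be j p) 0; first by apply: nearW.
  have [bq|bq] := eqVneq (be j q) 0; last first.
    by apply: filterS (near0_affine_neq0 p (be_affine j) bq).
  near=> t => bp; have t0 : 0 < t by near: t; exact: nbhs_right_gt.
  by rewrite be_affine bq mulr0 addr0 mulf_neq0 // gt_eqF.
move=> H; near=> t; split; first by near: t; exact: near0_mem_conv.
move=> j bt; apply: gp; apply/eqP; apply: contraPT bt => bp; apply/eqP.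
by move: j bp; near: t.
Unshelve. all: by end_near. Qed.

(** [be j q] is nonzero too, since by genericity of [q] a zero would make [be j] vanish on [U],
    hence at [p]. Both ends then have the same strict sign. *)
Let same_sign j p q (t : R) : generic p -> generic q -> pattern p = pattern q ->
  0 <= t -> t <= 1 -> be j p != 0 ->
  be j (t *: p + (1 - t) *: q) != 0 /\ (0 < be j (t *: p + (1 - t) *: q)) = (0 < be j p).
Proof.
move=> [Up gp] [Uq gq] pq t0 t1 bp; rewrite be_affine.
have bq : be j q != 0.
  by apply: contraNneq bp => /gq /(_ _ Up) ->.
have := congr1 (fun S : {set J} => j \in S) pq; rewrite !inE.
move: bp; rewrite neq_lt => /orP[bp|bp].
  rewrite [0 < be j p]ltNge (ltW bp) /= => /esym/negbT; rewrite -leNgt => bq'.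
  have {}bq : be j q < 0 by rewrite lt_def eq_sym bq.
  suff H : t * be j p + (1 - t) * be j q < 0 by rewrite lt_eqF // ltNge (ltW H).
  rewrite -oppr_gt0 opprD -!mulrN; apply: conv_gt; rewrite ?oppr_gt0 //.
rewrite bp => /esym bq'.
have H : 0 < t * be j p + (1 - t) * be j q by exact: conv_gt.
by rewrite H gt_eqF.
Qed.

Lemma convex_cell (s : {set J}) : convex_set [set p | generic p /\ pattern p = s].
Proof.
apply/convex_setP => p q t [gp ps] [gq qs] t0 t1.
have pq : pattern p = pattern q by rewrite ps qs.
have [Up gp'] := gp; have [Uq gq'] := gq.
split; first split; first exact: mem_conv.
  move=> j bj; apply: gp'; apply/eqP; apply: contraPT bj => bj.
  by have [/eqP] := same_sign gp gq pq t0 t1 bj.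
rewrite -ps; apply/setP => j; rewrite !inE.
have [bj|bj] := eqVneq (be j p) 0; last by have [] := same_sign gp gq pq t0 t1 bj.
by rewrite (gp' _ bj) ?bj ?ltxx //; exact: mem_conv.
Qed.

(** Losing feasibility between [p] and [q] would create a zero of some [al k l] on the segment,
    hence of a matching [be j]. Signs do not change inside a cell, so [be j] vanishes on [U], and
    then [al k l q] is zero rather than negative. *)
Lemma cell_feas k p q : generic p -> generic q -> pattern p = pattern q ->
  feas k p -> feas k q.
Proof.
move=> gp gq pq fp l; rewrite leNgt; apply/negP => aq; have ap := fp l.
have [Up gp'] := gp; have [Uq gq'] := gq.
(* The zero of the affine function [al k l] on the segment, [t] being the weight of [p]. *)
pose t := - al k l q / (al k l p - al k l q).
have D0 : 0 < al k l p - al k l q by lra.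
have t0 : 0 <= t by rewrite divr_ge0 //; lra.
have t1 : t <= 1 by rewrite ler_pdivrMr //; lra.
have Uz := mem_conv Up Uq t0 t1.
have az : al k l (t *: p + (1 - t) *: q) = 0.
  by rewrite al_affine /t; field; rewrite gt_eqF.
have [|j bj] := @be_al k l; first by exists (t *: p + (1 - t) *: q).
have /bj bz := az.
have [bp|bp] := eqVneq (be j p) 0.
  have /(bj _ Uq) aq0 := gp' _ bp _ Uq.
  by rewrite aq0 ltxx in aq.
by have [/eqP + _] := same_sign gp gq pq t0 t1 bp; apply; apply: bz.
Qed.

Lemma cell_cover (s : {set J}) : exists G : {set K}, (#|G| <= n.+1)%N /\
  forall p, generic p -> pattern p = s -> exists k, [/\ k \in G, feas k p & g k p <= v].
Proof.
apply: contrapT => /forallNP noG.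
(* The failure of every small [G] is exactly the finite intersection hypothesis of Helly's
   theorem. *)
have {}noG (G : {set K}) : (#|G| <= n.+1)%N -> exists p, [/\ generic p, pattern p = s
    & forall k, k \in G -> feas k p -> v < g k p].
  move=> Gn; have /not_andP[//|] := noG G.
  move=> /existsNP[p /not_implyP[gp /not_implyP[ps /forallNP H]]].
  exists p; split => // k kG fk; rewrite ltNge; apply/negP => gk.
  by apply: (H k).
(* The policies infeasible on the cell contribute the whole cell to Helly's family. *)
have [||p Kp] := @helly R n K (fun k => [set p | [/\ generic p, pattern p = s
    & feas k p -> v < g k p]]); last first.
(* An empty [K] would put no constraint on [p], so a policy [k0] is produced first in order to get
   [p] in [U]. *)
- have [|p0 [[Up0 _] _ _]] := noG finset.set0; first by rewrite cards0.
  have [k0 _ _] := feas_le Up0.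
  have [[Up _] _ _] := Kp k0.
  by have [k fk gk] := feas_le Up; have [_ _ /(_ fk)] := Kp k; rewrite ltNge gk.
- move=> S /noG [p [gp ps H]]; exists p => k kS; split => //; exact: H.
- move=> k; apply/convex_setP => p q t [gp ps fp] [gq qs fq] t0 t1.
  have /convex_setP cc := @convex_cell s.
  have [//|//|gz zs] := cc p q t _ _ t0 t1.
  split => // fz.
  have vp : v < g k p by apply/fp/(cell_feas gz) => //; rewrite zs.
  have vq : v < g k q by apply/fq/(cell_feas gz) => //; rewrite zs.
  have := convex_functionP (@concave_g k) (proj1 gp) (proj1 gq) t0 t1.
  have := conv_gt vp vq t0 t1; rewrite /= !mulrN -opprD lerN2.
  exact: lt_le_trans.
Qed.

Let patterns := [set s : {set J} | `[< exists2 p, generic p & pattern p = s >]]%SET.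

(** Given a relation [c] on a shattered [S], some generic point has every [be j] of sign opposite to
    [c j], making the combination negative. The same for [- c] makes it positive elsewhere, yet it
    is constant on [U]. *)
Lemma shattered_patterns (S : {set J}) : shatters patterns S -> (#|S| <= d)%N.
Proof.
move=> /shattersP sh; rewrite leqNgt; apply/negP => /be_dep [c [cS [i ci] [e ce]]].
have neg (w : J -> R) : (forall j, j \notin S -> w j = 0) -> w i != 0 ->
    exists2 p, U p & \sum_j w j * be j p < 0.
  move=> wS wi; have [|C] := sh [set j in S | w j < 0]%SET.
    by apply/fintype.subsetP => j; rewrite inE => /andP[].
  rewrite inE => /asboolP[p [Up gp] <-] CS; exists p => //.
  have wb j : w j != 0 -> w j * be j p < 0.
    move=> wj; have jS : j \in S by apply: contraNT wj => /wS ->.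
    have bj : be j p != 0.
      (* Shattering also realises the singleton of [j], so [be j] is positive somewhere on [U] and
         cannot vanish at the generic point [p]. *)
      have [|D] := sh [set j]%SET; first by rewrite finset.sub1set.
      rewrite inE => /asboolP[q [Uq gq] <-] qS.
      have : j \in pattern q :&: S by rewrite qS set11.
      rewrite !inE => /andP[bq _]; apply: contraTneq bq => bp.
      by rewrite (gp _ bp) // ltxx.
    have := congr1 (fun S : {set J} => j \in S) CS; rewrite !inE jS andbT /= => bw.
    move: wj; rewrite neq_lt => /orP[wj|wj].
      by rewrite nmulr_rlt0 // bw.
    rewrite pmulr_rlt0 // lt_def eq_sym bj /= leNgt bw.
    by rewrite -leNgt ltW.
  rewrite (bigD1 i) //= -[ltRHS]addr0 ltr_leD ?wb // sumr_le0 // => j _.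
  have [->|wj] := eqVneq (w j) 0; first by rewrite mul0r.
  exact/ltW/wb.
have [p Up] := neg c cS ci; rewrite ce // => e0.
have [|| q Uq] := neg (fun j => - c j); rewrite ?oppr_eq0 //.
  by move=> j /cS ->; rewrite oppr0.
under eq_bigr => j _ do rewrite mulNr.
by rewrite sumrN ce // oppr_lt0 ltNge (ltW e0).
Qed.

Lemma finite_cover : exists Y : {set K}, (#|Y| <= (1 + #|J| ^ d) * n.+1)%N /\
  forall p, U p -> exists k, [/\ k \in Y, feas k p & g k p <= v].
Proof.
have [G /all_and2[Gn Gc]] := choice cell_cover.
exists (\bigcup_(s in patterns) G s)%SET; split.
  apply: leq_trans (leq_card_bigcup _ _) _.
  apply: (@leq_trans (\sum_(s in patterns) n.+1)); first by apply: leq_sum.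
  rewrite sum_nat_const leq_mul2r /=.
  apply: leq_trans (card_le_shattered _) _.
  apply: leq_trans (card_small_sets _ d); apply: subset_leq_card.
  by apply/fintype.subsetP => S; rewrite !inE; exact: shattered_patterns.
move=> q Uq; apply: contrapT => /forallNP bad.
have [p gp] : exists p, generic p by apply: exists_generic; exists q.
(* Every selected policy fails at [q]. An infeasible one stays infeasible close to [q]; one that is
   too expensive stays so along the segment, as concavity bounds its cost below by the interpolated
   values. *)
have : \forall t \near 0^'+, forall k, k \in (\bigcup_(s in patterns) G s)%SET ->
    ~ (feas k (t *: p + (1 - t) *: q) /\ g k (t *: p + (1 - t) *: q) <= v).
  apply: filter_forall => k.
  have [kY|kY] := boolP (k \in (\bigcup_(s in patterns) G s)%SET); last exact: nearW.
  have [/existsNP[l /negP]|fq] := pselect (~ feas k q).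
    rewrite -ltNge -oppr_gt0 => aq; near=> t => _ -[/(_ l)+ _]; apply/negP.
    rewrite -ltNge al_affine -oppr_gt0 opprD -!mulrN; near: t; exact: near0_conv_gt.
  have {}fq : feas k q by apply: contrapT.
  have gq : v < g k q by rewrite ltNge; apply/negP => gq; apply: (bad k).
  near=> t => _ -[_]; apply/negP; rewrite -ltNge.
  have t0 : 0 <= t by apply: ltW; near: t; exact: nbhs_right_gt.
  have t1 : t <= 1 by apply: ltW; near: t; exact: nbhs_right_lt.
  have := convex_functionP (@concave_g k) (proj1 gp) Uq t0 t1.
  rewrite /= !mulrN -opprD lerN2; apply: lt_le_trans; near: t; exact: near0_conv_gt.
(* Close to [q] the segment consists of generic points, whose cells are covered by construction. *)
move=> H; near (0 : R)^'+ => t.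
have gt : generic (t *: p + (1 - t) *: q) by near: t; exact: near0_generic.
have [k [kG fk gk]] := Gc _ _ gt erefl.
have : forall k, k \in (\bigcup_(s in patterns) G s)%SET ->
    ~ (feas k (t *: p + (1 - t) *: q) /\ g k (t *: p + (1 - t) *: q) <= v) by near: t.
apply; last by split; [exact: fk | exact: gk].
apply/bigcupP; exists (pattern (t *: p + (1 - t) *: q)) => //.
by rewrite inE; apply/asboolP; exists (t *: p + (1 - t) *: q).
Unshelve. all: by end_near. Qed.

End Cover.

(** Each entry is an integer in [-N, N), coded by an element of ['I_(N + N)] after a shift by N. *)
Lemma finite_bounded_int (R : realType) n (A : set 'cV[R]_n) :
  (forall y, A y -> y \is a mxOver Num.int) -> bounded_set A -> finite_set A.
Proof.
move=> intA /pinfty_ex_gt0 [M M0 AM].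
pose N := (Num.truncn M).+1.
have MN : M < N%:R by exact: truncnS_gt.
pose f (u : {ffun 'I_n -> 'I_(N + N)}) : 'cV[R]_n := \col_i ((u i)%:R - N%:R).
apply: (@sub_finite_set _ _ (range f)); last exact/finite_image/finite_finset.
move=> y Ay; have yM := AM y Ay; have /mxOverP yint := intA y Ay.
have bnd i : exists k : 'I_(N + N), y i 0 = k%:R - N%:R.
  have /intrP[z yz] := yint i 0.
  have : `|y i 0| < N%:R.
    apply: le_lt_trans MN; apply: le_trans yM.
    rewrite [leRHS]/Num.norm /= mx_normrE.
    by apply/bigmax_geP; right => /=; exists (i, 0).
  rewrite yz -[N%:R]/((N%:Z)%:~R) -intr_norm ltr_int => zN.
  have [k kE] : exists k : nat, z + N%:Z = k%:Z by exists (absz (z + N%:Z)); lia.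
  have kN : (k < N + N)%N by lia.
  exists (Ordinal kN) => /=; rewrite -[k%:R]/((k%:Z)%:~R).
  by rewrite -kE rmorphD addrK.
have [u yu] := choice bnd.
exists [ffun i => u i] => //; apply/colP => i.
by rewrite !mxE ffunE yu.
Qed.

(** * Constraints and policies of an instance *)

Section Instance.
Variables (R : realType) (nx ny nxi m : nat) (P : instance R nx ny nxi m).
Implicit Types (x : 'cV[R]_nx) (y : 'cV[R]_ny) (xi : 'cV[R]_nxi).

Definition slack x y (l : 'I_m) xi : R :=
  (row l (a_mx P x y) *m xi) 0 0 - h_vec P x y l 0.

Lemma slack_affine x y l : affine (slack x y l).
Proof.
move=> p q t; rewrite /slack mulmxDr -!scalemxAr.
set u := row _ _ *m p; set w := row _ _ *m q; rewrite !mxE; ring.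
Qed.

Lemma hyperplaneE x y l xi : hyperplane P x y l xi <-> slack x y l xi = 0.
Proof.
by rewrite /slack; split=> [->|/eqP]; rewrite ?subrr // subr_eq0 => /eqP.
Qed.

Lemma slackE x y l xi :
  slack x y l xi = (A_ P xi *m x + B_ P xi *m y) l 0 - h_ P xi l 0.
Proof.
rewrite /slack /A_ /B_ /h_ /h_vec !mulmxDl !mulmx_suml.
have -> : (row l (a_mx P x y) *m xi) 0 0 =
    \sum_i xi i 0 * (map_mx intr (Ai P i) *m x) l 0
    + \sum_i xi i 0 * (map_mx intr (Bi P i) *m y) l 0
    - (map_mx intr (H0 P) *m xi) l 0.
  rewrite [X in _ - X]mxE -big_split /= -sumrB mxE; apply: eq_bigr => i _.
  rewrite [row _ _ _ _]mxE [a_mx _ _ _ _ _]mxE.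
  set u := _ *m x; set w := _ *m y; rewrite !mxE; ring.
have -> (M : 'I_nxi -> 'M[R]_(m, nx)) :
   \sum_i xi i 0 * (M i *m x) l 0 = (\sum_i xi i 0 *: M i *m x) l 0.
  by rewrite summxE; apply: eq_bigr => i _; rewrite -scalemxAl [RHS]mxE.
have -> (M : 'I_nxi -> 'M[R]_(m, ny)) :
   \sum_i xi i 0 * (M i *m y) l 0 = (\sum_i xi i 0 *: M i *m y) l 0.
  by rewrite summxE; apply: eq_bigr => i _; rewrite -scalemxAl [RHS]mxE.
set a1 := \sum_i _; set a2 := \sum_i _.
set a3 := _ *m x; set a4 := _ *m y; set a5 := _ *m xi.
rewrite !mxE; ring.
Qed.

Lemma satisfiesP x y xi : satisfies P x y xi <-> forall l, 0 <= slack x y l xi.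
Proof.
split=> [/forallP H l|H]; first by rewrite slackE subr_ge0 H.
by apply/forallP => l; have := H l; rewrite slackE subr_ge0.
Qed.

(** More than [nxi] rows of length [nxi] are linearly dependent, and the [h_vec] terms contribute
    only a constant. *)
Lemma slack_dependence x (J : finType) (r : J -> 'cV[R]_ny * 'I_m) (S : {set J}) :
  (nxi < #|S|)%N -> dependent_on (Uset P) (fun j => slack x (r j).1 (r j).2) S.
Proof.
move=> /(exists_linear_dependence (fun j => row (r j).2 (a_mx P x (r j).1))).
move=> [c [cS c0 cv]]; exists c; split => //.
exists (- \sum_j c j * h_vec P x (r j).1 (r j).2 0) => p _.
have := congr1 (fun u => (u *m p) 0 0) cv.
rewrite mul0mx [RHS]mxE mulmx_suml summxE => e0.
rewrite -[RHS]add0r -[X in _ = X + _]e0.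
rewrite -sumrB; apply: eq_bigr => j _; rewrite /slack mulrBr; congr (_ - _).
by rewrite -scalemxAl [RHS]mxE.
Qed.

Lemma fixed_slackB x y y' l : fixed_recourse P ->
  exists e, forall p, Uset P p -> slack x y l p - slack x y' l p = e.
Proof.
move=> fr; exists ((map_mx intr (B0 P) *m y) l 0 - (map_mx intr (B0 P) *m y') l 0).
move=> p Up; rewrite !slackE fr // !mxE; ring.
Qed.

(** By pigeonhole two members of [S] share the constraint index [l]; under fixed recourse their
    difference is constant on [U]. *)
Lemma fixed_slack_dependence x (J : finType) (r : J -> 'cV[R]_ny * 'I_m) (S : {set J}) :
  fixed_recourse P -> (m < #|S|)%N ->
  dependent_on (Uset P) (fun j => slack x (r j).1 (r j).2) S.
Proof.
move=> fr mS.
have [j [j' [jS j'S jj' rjj']]] :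
    exists j j', [/\ j \in S, j' \in S, j != j' & (r j).2 = (r j').2].
  apply: contrapT => H.
  have inj : {in S &, injective (fun j => (r j).2)}.
    move=> j j' jS j'S e; apply/eqP; apply: contrapT => /negP jj'.
    by apply: H; exists j, j'.
  have := max_card [set (r j).2 | j in S]%SET.
  by rewrite card_in_imset // card_ord leqNgt mS.
exists (fun i => (i == j)%:R - (i == j')%:R); split.
- move=> i iS; have -> : i == j = false by apply: contraNF iS => /eqP ->.
  by have -> : i == j' = false; [apply: contraNF iS => /eqP -> | rewrite subrr].
- by exists j; rewrite eqxx (negPf jj') subr0 oner_neq0.
- have [e He] := fixed_slackB x (r j).1 (r j').1 (r j).2 fr.
  exists e => p Up; rewrite -(He p Up).
  have D (F : J -> R) i0 : \sum_i (i == i0)%:R * F i = F i0.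
    by rewrite (bigD1 i0) //= eqxx mul1r big1 ?addr0 // => i /negPf ->; rewrite mul0r.
  under eq_bigr => i _ do rewrite mulrBl.
  by rewrite sumrB !D rjj'.
Qed.

Section Feasible.
Variable x : 'cV[R]_nx.
Hypothesis finY : finite_set (Yat P x).

Lemma hyperplanes_sub :
  hyperplanes P x `<=` [set hyperplane P x p.1 p.2 | p in Yat P x `*` [set: 'I_m]].
Proof. by move=> Q [y [l [Yy -> _]]]; exists (y, l). Qed.

Lemma finite_hyperplanes : finite_set (hyperplanes P x).
Proof.
apply: sub_finite_set hyperplanes_sub _; apply: finite_image.
exact: finite_setX.
Qed.

Lemma finite_policies d (v : R) : convex_set (Uset P) ->
  (forall y, Yat P x y -> convex_function (Uset P) (\- cost P x y)) ->
  (forall xi, Uset P xi -> exists y,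
    [/\ Yat P x y, satisfies P x y xi & cost P x y xi <= v]) ->
  (forall (J : finType) (r : J -> 'cV[R]_ny * 'I_m) (S : {set J}), (d < #|S|)%N ->
    dependent_on (Uset P) (fun j => slack x (r j).1 (r j).2) S) ->
  exists s : seq 'cV[R]_ny,
    [/\ (size s <= (1 + #|` fset_set (hyperplanes P x)| ^ d) * nxi.+1)%N,
        forall y, y \in s -> Yat P x y &
        forall xi, Uset P xi ->
          exists y, [/\ y \in s, satisfies P x y xi & cost P x y xi <= v]].
Proof.
move=> cU cg hv dep; have finH := finite_hyperplanes.
pose K : finType := fset_set (Yat P x); pose J : finType := fset_set (hyperplanes P x).
have inY (k : K) : Yat P x (val k) by have := valP k; rewrite in_fset_set // inE.
(* One pair (y, l) is chosen for each hyperplane; other pairs defining it have slacks with the same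
   zero set. *)
have rep (j : J) : exists p : 'cV[R]_ny * 'I_m, val j = hyperplane P x p.1 p.2.
  have : val j \in hyperplanes P x by rewrite -in_fset_set // (valP j).
  by rewrite inE => -[y [l [_ jE _]]]; exists (y, l).
have [r rE] := choice rep.
have [||||||Y [cY covY]] := @finite_cover R nxi d (Uset P) K 'I_m J
  (fun k => slack x (val k)) (fun j => slack x (r j).1 (r j).2)
  (fun k => cost P x (val k)) v cU.
- by move=> k l; exact: slack_affine.
- by move=> j; exact: slack_affine.
- move=> k l [p Up /hyperplaneE pk].
  have Hk : hyperplane P x (val k) l \in fset_set (hyperplanes P x).
    rewrite in_fset_set // inE; exists (val k), l; split => //.
    by exists p.
  exists [` Hk]%fset => q _; rewrite -!hyperplaneE.
  by rewrite -rE.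
- by move=> k; exact: cg.
- by move=> S; exact: dep.
- move=> p /hv [y [Yy sy gy]].
  have yK : y \in fset_set (Yat P x) by rewrite in_fset_set // inE.
  by exists [` yK]%fset => //; apply/satisfiesP.
exists [seq val k | k <- enum Y]; split.
- by rewrite size_map -cardE cardfE.
- by move=> y /mapP[k _ ->].
- move=> xi /covY [k [kY fk gk]]; exists (val k); split => //.
    by apply: map_f; rewrite mem_enum.
  by apply/satisfiesP.
Qed.

(** The inner infimum runs over a finite nonempty set, so it is attained. *)
Lemma le_two_stage_obj (v : \bar R) : (two_stage_obj P x <= v)%E -> Yat P x !=set0 ->
  forall xi, Uset P xi -> exists2 y, Yat P x y & (obj P x y xi <= v)%E.
Proof.
move=> /ereal_supP H [y0 Yy0] xi Uxi.
have infv := H _ (ex_intro2 _ _ xi Uxi erefl).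
pose K : finType := fset_set (Yat P x).
have y0K : y0 \in fset_set (Yat P x) by rewrite in_fset_set // inE.
case: (@arg_minP _ _ K [` y0K]%fset xpredT (fun k => obj P x (val k) xi) isT) => k _ kmin.
have Yk : Yat P x (val k) by have := valP k; rewrite in_fset_set // inE.
exists (val k) => //; apply: le_trans infv; apply/ereal_infP => _ [y Yy <-].
have yK : y \in fset_set (Yat P x) by rewrite in_fset_set // inE.
exact: (kmin [` yK]%fset isT).
Qed.

Lemma adapt_objP k (ys : 'I_k -> 'cV[R]_ny) (v : \bar R) :
  (forall xi, Uset P xi -> exists i, (obj P x (ys i) xi <= v)%E) ->
  (adapt_obj P x ys <= v)%E.
Proof.
move=> H; apply/ereal_supP => _ [xi Uxi <-]; have [i iv] := H xi Uxi.
by apply: ge_ereal_inf; exists (obj P x (ys i) xi) => //; exists i.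
Qed.

(** The bound on [k] is conditional on feasibility because [etaH] ranges over [Xfeas] only. At an
    infeasible [x] the two-stage value is +oo and any choice of policies will do. *)
Lemma adapt_obj_le d k : convex_set (Uset P) ->
  (forall y, Yat P x y -> convex_function (Uset P) (\- cost P x y)) ->
  (forall (J : finType) (r : J -> 'cV[R]_ny * 'I_m) (S : {set J}), (d < #|S|)%N ->
    dependent_on (Uset P) (fun j => slack x (r j).1 (r j).2) S) ->
  (0 < k)%N ->
  ((forall xi, Uset P xi -> exists y, Yat P x y /\ satisfies P x y xi) ->
    ((1 + #|` fset_set (hyperplanes P x)| ^ d) * nxi.+1 <= k)%N) ->
  Yat P x !=set0 ->
  exists ys : 'I_k -> 'cV[R]_ny,
    (forall i, Yat P x (ys i)) /\ (adapt_obj P x ys <= two_stage_obj P x)%E.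
Proof.
move=> cU cg dep k0 hk Y0; have [y0 Yy0] := Y0.
have := le_two_stage_obj (lexx _) Y0.
case: (two_stage_obj P x) => [v|_|H]; last 2 first.
- by exists (fun=> y0); split => //; rewrite leey.
- exists (fun=> y0); split => //; apply: adapt_objP => xi /H[y _].
  by rewrite /obj; case: ifP.
move=> H.
have hv xi : Uset P xi -> exists y,
    [/\ Yat P x y, satisfies P x y xi & cost P x y xi <= v].
  by move=> /H[y Yy]; rewrite /obj; case: ifP => // sy gy; exists y.
have [s [sk sY sv]] := finite_policies cU cg hv dep.
have {}sk : (size s <= k)%N.
  by apply: leq_trans sk (hk _) => xi /hv[y [Yy sy _]]; exists y.
exists (fun i => nth y0 s i); split.
  move=> i; have [iS|iS] := ltnP i (size s); first by apply/sY/mem_nth.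
  by rewrite nth_default.
apply: adapt_objP => xi /sv [y [ys sy gy]].
have yk : (index y s < k)%N by apply: leq_trans sk; rewrite index_mem.
by exists (Ordinal yk); rewrite /= nth_index // /obj sy lee_fin.
Qed.

Lemma two_stage_le_adapt k (ys : 'I_k -> 'cV[R]_ny) : (forall i, Yat P x (ys i)) ->
  (two_stage_obj P x <= adapt_obj P x ys)%E.
Proof.
move=> Yys; apply/ereal_supP => _ [xi Uxi <-].
apply: le_ereal_sup_tmp; exists (ereal_inf (range (fun i => obj P x (ys i) xi))).
  by exists xi.
apply/ereal_infP => _ [i _ <-]; apply: ge_ereal_inf.
by exists (obj P x (ys i) xi) => //; exists (ys i).
Qed.

End Feasible.

(** * Equality of optimal values and the number of policies *)

Lemma ensures_optimal_of k :
  (exists x, Xset P x /\ Yat P x !=set0) ->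
  (forall x, Xset P x -> Yat P x !=set0 -> exists ys : 'I_k -> 'cV[R]_ny,
    (forall i, Yat P x (ys i)) /\ (adapt_obj P x ys <= two_stage_obj P x)%E) ->
  ensures_optimal P k.
Proof.
move=> [x0 [Xx0 Yx0]] H.
have two_stage_val_le x : Xset P x -> (two_stage_val P <= two_stage_obj P x)%E.
  by move=> Xx; apply: ge_ereal_inf; exists (two_stage_obj P x) => //; exists x.
have adapt_val_le x (ys : 'I_k -> 'cV[R]_ny) : Xset P x -> (forall i, Yat P x (ys i)) ->
    (adapt_val P k <= adapt_obj P x ys)%E.
  by move=> Xx Yys; apply: ge_ereal_inf; exists (adapt_obj P x ys) => //; exists (x, ys).
have valE : adapt_val P k = two_stage_val P.
  apply/eqP; rewrite eq_le; apply/andP; split; last first.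
    apply/ereal_infP => _ [[x ys] [/= Xx Yys] <-].
    by apply: le_trans (two_stage_val_le _ Xx) (two_stage_le_adapt Yys).
  apply/ereal_infP => _ [x Xx <-].
  have [Yx|/set0P/negP/negPn/eqP Yx] := pselect (Yat P x !=set0).
    by have [ys [Yys le]] := H x Xx Yx; apply: le_trans le; exact: adapt_val_le.
  (* Without policies at [x], its value is +oo if [U] has a point; if [U] is empty, the policies at
     [x0] already give the adaptable value -oo. *)
  have [[xi Uxi]|/set0P/negP/negPn/eqP U0] := pselect (Uset P !=set0).
    apply: le_trans (leey _) _; apply: le_ereal_sup_tmp.
    exists +oo%E => //; exists xi => //.
    by rewrite Yx image_set0 ereal_inf0.
  have [ys [Yys _]] := H x0 Xx0 Yx0; apply: le_trans (adapt_val_le _ _ Xx0 Yys) _.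
  by rewrite /adapt_obj U0 image_set0 ereal_sup0 leNye.
split => //.
- move=> x ys [[/= Xx Yys] opt]; split => //; apply/eqP.
  by rewrite eq_le two_stage_val_le // andbT -valE -opt two_stage_le_adapt.
- move=> x [Xx opt] Yx; have [ys [Yys le]] := H x Xx Yx; exists ys.
  split => //; apply/eqP; rewrite eq_le [X in _ && X]adapt_val_le // andbT.
  by rewrite valE -opt.
Qed.

(** A supremum bounds its members only if the set is bounded above; the number of pairs (y, l) is
    such a bound, uniform in [x]. *)
Lemma card_hyperplanes_le_etaH x : finite_set (Yset P) ->
  (forall x, Xset P x -> Yat P x `<=` Yset P) -> Xfeas P x ->
  (maxn 1 #|` fset_set (hyperplanes P x)|)%:R <= etaH P.
Proof.
move=> finY subY Fx; rewrite /etaH.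
have ub : has_ubound [set ((#|` fset_set (hyperplanes P z)|)%:R : R) | z in Xfeas P].
  exists (#|` fset_set (Yset P `*` [set: 'I_m])|)%:R => _ [z [Xz _] <-]; rewrite ler_nat.
  have finYz := sub_finite_set (subY z Xz) finY.
  pose D := Yat P z `*` [set: 'I_m].
  have finD : finite_set D by exact: finite_setX.
  apply: (@leq_trans #|` fset_set D|); last first.
    have finE : finite_set (Yset P `*` [set: 'I_m]) by exact: finite_setX.
    apply: fsubset_leq_card; rewrite -(fset_set_sub finD finE).
    by move=> [y l] [/= Yy _]; split => //; exact: (subY z).
  apply: (@leq_trans #|` fset_set [set hyperplane P z p.1 p.2 | p in D]|).
    apply: fsubset_leq_card; rewrite -fset_set_sub //.
    - exact: hyperplanes_sub.
    - exact: finite_hyperplanes.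
    - exact: finite_image.
  rewrite fset_set_image //; exact: leq_imfset_card.
rewrite natr_max ge_max le_max lexx /= le_max orbC ub_le_sup //.
by exists x.
Qed.

Lemma policies_needed_le_etaH d :
  finite_set (Yset P) -> (forall x, Xset P x -> Yat P x `<=` Yset P) ->
  convex_set (Uset P) ->
  (forall x y, Xset P x -> Yset P y -> convex_function (Uset P) (\- cost P x y)) ->
  (exists x y, Xset P x /\ Yat P x y) ->
  (forall x (J : finType) (r : J -> 'cV[R]_ny * 'I_m) (S : {set J}), (d < #|S|)%N ->
    dependent_on (Uset P) (fun j => slack x (r j).1 (r j).2) S) ->
  policies_needed_le P (2%:R * (etaH P ^+ d * nxi.+1%:R)).
Proof.
move=> finY subY cU cg [x0 [y0 [Xx0 Yy0]]] dep.
have eta1 : 1 <= etaH P by rewrite /etaH le_max lexx.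
(* The bound b >= 1 ensures that the truncation below is at least 1, so that a policy is
   available. *)
set b := 2%:R * _; have b1 : 1 <= b.
  have ed : 1 <= etaH P ^+ d by exact: exprn_ege1.
  have n0 : 0 <= nxi%:R :> R by exact: ler0n.
  by rewrite /b -natr1; nra.
have b0 : 0 <= b by apply: le_trans b1.
exists (Num.truncn b); split; first by rewrite truncn_le.
move=> k bk; apply: ensures_optimal_of; first by exists x0; split => //; exists y0.
move=> x Xx; apply: (@adapt_obj_le x _ d) => //.
- exact: sub_finite_set (subY x Xx) finY.
- by move=> y Yy; apply: cg => //; exact: (subY x).
- exact: dep.
- by apply: leq_trans bk; rewrite truncn_gt0.
move=> feas; apply: leq_trans bk; rewrite truncn_ge_nat //.
have := card_hyperplanes_le_etaH finY subY (conj Xx feas : Xfeas P x).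
set N := #|` _| => Neta.
(* The constant 2 comes from 1 + N^d <= 2 max(1, N)^d, where the maximum also handles N = 0. *)
apply: (@le_trans _ _ ((2 * maxn 1 N ^ d) * nxi.+1)%N%:R).
  rewrite ler_nat leq_mul2r /= mul2n -addnn leq_add //.
    by rewrite expn_gt0 leq_max.
  by case: (d) => [|e]; rewrite ?expn0 ?leq_exp2r ?leq_maxr.
rewrite !natrM natrX -mulrA ler_wpM2l // ler_wpM2r // lerXn2r ?nnegrE //.
exact: le_trans eta1.
Qed.

End Instance.

Theorem theorem17 (R : realType) :
  exists C : nat,
  forall (nx ny nxi m : nat) (P : instance R nx ny nxi m),
    compact (Xset P) ->
    (forall y, Yset P y -> y \is a mxOver Num.int) ->
    bounded_set (Yset P) ->
    (forall x, Xset P x -> Yat P x `<=` Yset P) ->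
    convex_set (Uset P) ->
    compact (Uset P) ->
    {within (Xset P `*` Yset P) `*` Uset P,
      continuous (fun p => cost P p.1.1 p.1.2 p.2)} ->
    (forall x y, Xset P x -> Yset P y -> convex_function (Uset P) (\- cost P x y)) ->
    (exists x y, [/\ Xset P x, Yat P x y
      & forall xi, Uset P xi -> satisfies P x y xi]) ->
    (fixed_recourse P ->
      policies_needed_le P (C%:R * (etaH P ^+ minn m nxi * nxi.+1%:R))) /\
    policies_needed_le P (C%:R * (etaH P ^+ nxi * nxi.+1%:R)).
Proof.
exists 2 => nx ny nxi m P _ intY bdY subY cU _ _ cg [x0 [y0 [Xx0 Yy0 _]]].
have finY := finite_bounded_int intY bdY.
have ex : exists x y, Xset P x /\ Yat P x y by exists x0, y0.
split=> [fr|]; apply: policies_needed_le_etaH => // x J r S; last exact: slack_dependence.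
(* Exceeding the minimum means exceeding [m] or [nxi], and each case has its own source of
   dependence. *)
by rewrite gtn_min => /orP[]; [exact: fixed_slack_dependence | exact: slack_dependence].
Qed.
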